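(* If $\xi,\eta\in \mathrm{c}_{\mathrm{o}}^*$ and $\xi\notin(\ell^1)^*$, then $\xi\prec\eta$ if and only if $\xi=Q\eta$ for some orthostochastic matrix $Q$.
   Context: $\mathrm{c}_{\mathrm{o}}^*$ denotes the cone of nonnegative monotone nonincreasing sequences converging to $0$, and $(\ell^1)^*$ the subcone of summable ones (neither denotes a dual space). For $\xi,\eta\in \mathrm{c}_{\mathrm{o}}^*$, $\xi\prec\eta$ means $\sum_{j=1}^n\xi_j\le\sum_{j=1}^n\eta_j$ for every $n\in\mathbb N$. An infinite matrix $Q=(Q_{ij})_{i,j\in\mathbb N}$ is orthostochastic if $Q_{ij}=(U_{ij})^2$ for all $i,j$, where $U$ is an orthogonal matrix, i.e., the matrix of a unitary operator on $\ell^2$ with real entries. $Q\eta$ is the sequence $\langle\sum_{j=1}^\infty Q_{ij}\eta_j\rangle_i$. *)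

(* Defs.v *)
From HB Require Import structures.
From mathcomp Require Import all_boot all_order all_algebra.
From mathcomp Require Import all_classical all_reals all_analysis.
From mathcomp Require Import complex.

Set Implicit Arguments.
Unset Strict Implicit.
Unset Printing Implicit Defensive.

Import Order.TTheory GRing.Theory Num.Theory.
Import numFieldNormedType.Exports.

Local Open Scope classical_set_scope.
Local Open Scope ring_scope.

(* Sequences and matrices are indexed from 0. *)

Definition co_star (R : realType) (xi : nat -> R) : Prop :=
  [/\ forall n, 0 <= xi n, nonincreasing_seq xi & xi @ \oo --> (0 : R)].

Definition l1_star (R : realType) (xi : nat -> R) : Prop :=
  co_star xi /\ cvgn (series xi).

Definition majorized (R : realType) (xi eta : nat -> R) : Prop :=
  forall n : nat, \sum_(j < n) xi j <= \sum_(j < n) eta j.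

Definition l2_sqnorm (R : realType) (x : nat -> R[i]) : \bar R :=
  (\sum_(0 <= n <oo) ((ComplexField.Normc.normc (x n)) ^+ 2)%:E)%E.

Definition in_l2 (R : realType) (x : nat -> R[i]) : Prop :=
  (l2_sqnorm x < +oo)%E.

(* Unitary operator on complex l^2, i.e., a surjective linear isometry; only
   the values of [T] on [in_l2] are relevant. *)
Definition unitary_op (R : realType)
    (T : (nat -> R[i]) -> (nat -> R[i])) : Prop :=
  [/\ forall x, in_l2 x -> in_l2 (T x),
      forall (a : R[i]) x y, in_l2 x -> in_l2 y ->
        T (fun n => a * x n + y n) = (fun n => a * T x n + T y n),
      forall x, in_l2 x -> l2_sqnorm (T x) = l2_sqnorm x
    & forall y, in_l2 y -> exists2 x, in_l2 x & T x = y].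

Definition l2_basis (R : realType) (j : nat) : nat -> R[i] :=
  fun i => (i == j)%:R.

Definition orthogonal_matrix (R : realType) (U : nat -> nat -> R) : Prop :=
  exists2 T : (nat -> R[i]) -> (nat -> R[i]),
    unitary_op T & forall i j, T (l2_basis R j) i = ((U i j)%:C)%C.

Definition orthostochastic (R : realType) (Q : nat -> nat -> R) : Prop :=
  exists2 U : nat -> nat -> R,
    orthogonal_matrix U & forall i j, Q i j = U i j ^+ 2.

(* For [Q] orthostochastic and [eta] bounded, every series below converges, so
   the default value of [limn] plays no role. *)
Definition matrix_seq_mul (R : realType) (Q : nat -> nat -> R)
    (eta : nat -> R) : nat -> R :=
  fun i => limn (series (fun j => Q i j * eta j)).

(* Main.v *)
Require Import Defs.
From HB Require Import structures.
From mathcomp Require Import all_boot all_order all_algebra.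
From mathcomp Require Import all_classical all_reals all_analysis.
From mathcomp Require Import complex.
From mathcomp Require Import zify ring lra.

(* If [Q] is orthostochastic, its row and column sums are at most 1, and the
   partial sums of [Q eta] are weighted sums of [eta] with weights in [0, 1] of
   total mass at most [n].

   Conversely, the rows [u_0, u_1, ...] of the orthogonal matrix are built greedily
   so that [u_n] has value [<D u_n, u_n> = xi n], where [D = diag eta].  At each
   time there are finitely many pending unit vectors with disjoint supports, the
   other basis vectors being fresh.  If [p] and [q] are pending of values
   [b <= xi n <= a], rotating in their plane yields [u_n] and one new pending vector
   of value [a + b - xi n].  Since a pending vector of value [v] has squared entry
   at most [v / eta j] in column [j], the column [j] of the matrix has norm 1 as soon
   as the values of the pending vectors supporting [j] have lower limit 0.

   Say that a remaining problem is good if at most one pending value is below the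
   next [xi n], and if every excess (pending values plus the first [l] fresh ones,
   minus as many terms of [xi]) is nonnegative.  Then no pending value exceeds the
   excess at [l = 0] plus [2 * xi n].  To lower the value of a given pending
   vector: if some excess is below [xi n], processing the first [l] fresh vectors
   makes every pending value at most [3 * xi n]; otherwise one can afford to rotate
   the given vector against a far fresh one, which lowers its value by at least
   [xi n / 2].  As the sum of [xi] diverges, the second case cannot go on forever. *)

Set Implicit Arguments.
Unset Strict Implicit.
Unset Printing Implicit Defensive.

Import Order.TTheory GRing.Theory Num.Theory.
Import numFieldNormedType.Exports.

Local Open Scope classical_set_scope.
Local Open Scope ring_scope.

(** * Finite sums, convex combinations and limits *)

Section Sums.
Variable R : realType.

Lemma sum_cond_recr (K : nat) (P : pred nat) (F : nat -> R) :
  \sum_(j < K.+1 | P j) F j = \sum_(j < K | P j) F j + (if P K then F K else 0).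
Proof. by rewrite big_mkcond big_ord_recr /= -big_mkcond. Qed.

Lemma sum_ord_stable (F : nat -> R) K L : (K <= L)%N ->
  (forall j, (K <= j)%N -> F j = 0) -> \sum_(j < L) F j = \sum_(j < K) F j.
Proof.
move=> /subnKC <- F0; rewrite big_split_ord /= [X in _ + X]big1 ?addr0// => i _.
by rewrite F0// leq_addr.
Qed.

Lemma sum_skip (f : nat -> R) k l : (k <= l)%N ->
  f k + \sum_(i < l) f (if (i < k)%N then i : nat else i.+1) = \sum_(i < l.+1) f i.
Proof.
elim: l => [|l IH]; first by case: k => // _; rewrite big_ord0 big_ord1 addr0.
rewrite leq_eqVlt => /orP[/eqP ->|kl].
  rewrite [in RHS]big_ord_recr /= [RHS]addrC; congr (_ + _).
  by apply: eq_bigr => i _; rewrite ltn_ord.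
rewrite big_ord_recr /= addrA IH// [in RHS]big_ord_recr /=.
by rewrite ltnNge -ltnS kl.
Qed.

(** [c] and [d] are the cosine and sine of the rotation angle; their squares are the weights that
    place [x] between [b] and [a]. *)
Lemma convex_squares (a b x : R) : b <= x -> x <= a ->
  exists c d : R, c ^+ 2 + d ^+ 2 = 1 /\ c ^+ 2 * a + d ^+ 2 * b = x.
Proof.
move=> bx xa; have [ab|ab] := eqVneq a b.
  exists 1, 0; split; first by rewrite expr1n expr0n addr0.
  by rewrite expr1n expr0n mul1r mul0r addr0; apply/eqP; rewrite eq_le xa ab bx.
have ab0 : a - b > 0 by rewrite subr_gt0 lt_neqAle eq_sym ab (le_trans bx xa).
exists (Num.sqrt ((x - b) / (a - b))), (Num.sqrt ((a - x) / (a - b))).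
rewrite !sqr_sqrtr ?divr_ge0 ?subr_ge0 ?(ltW ab0) ?(le_trans bx xa)//.
by split; field; rewrite gt_eqF.
Qed.

(** The free [t] lets a vanishing factor [b] absorb a merely bounded [a]. *)
Lemma weighted_square_le (a b t : R) : 0 < t -> `|a * b| *+ 2 <= t * a ^+ 2 + b ^+ 2 / t.
Proof.
move=> t0; rewrite normrM -(real_normK (num_real a)) -(real_normK (num_real b)).
have -> : t * `|a| ^+ 2 + `|b| ^+ 2 / t =
   `|a| * `|b| *+ 2 + (t * `|a| - `|b|) ^+ 2 / t by field; rewrite gt_eqF.
by rewrite lerDl divr_ge0 ?sqr_ge0// ltW.
Qed.

Lemma cvg_sum_ord J (u : nat -> nat -> R) (l : nat -> R) :
  (forall j, (j < J)%N -> u j @ \oo --> l j) ->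
  (fun n => \sum_(j < J) u j n) @ \oo --> \sum_(j < J) l j.
Proof.
elim: J => [_|J IH h].
  by under eq_fun do rewrite big_ord0; rewrite big_ord0; exact: cvg_cst.
under eq_fun do rewrite big_ord_recr; rewrite big_ord_recr.
by apply: cvgD; [apply: IH => j /ltnW; exact: h | exact: h].
Qed.

End Sums.

(** * Rotations of pending vectors *)

Section Rotations.
Variables (R : realType) (xi eta : nat -> R).

(* The pending or fresh vector named [s] is the sum of the [wt j *: e_j] over the [j]
   with [slot j = s], and [lev s] is its value; [act] lists the pending names, and
   [s] is retired when [slot s <> s]. *)
Record state := State {
  cnt : nat;
  row : nat -> nat -> R;
  slot : nat -> nat;
  wt : nat -> R;
  lev : nat -> R;
  act : seq nat;
  fresh : nat -> nat }.

(** [K] bounds the columns touched so far; it keeps all sums finite and may be enlarged. [inv_col]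
    is Parseval's identity for [e_j], which meets only the retired rows and the vector named
    [slot X j]. *)
Record ortho_inv (X : state) (K : nat) : Prop := OrthoInv {
  inv_slot_out : forall j, (K <= j)%N -> slot X j = j;
  inv_slot_lt : forall j, (j < K)%N -> (slot X j < K)%N;
  inv_wt_out : forall j, (K <= j)%N -> wt X j = 1;
  inv_lev_out : forall j, (K <= j)%N -> lev X j = eta j;
  inv_row_out : forall i j, (i < cnt X)%N -> (K <= j)%N -> row X i j = 0;
  inv_norm : forall s, (s < K)%N -> slot X s = s ->
    \sum_(j < K | slot X j == s) wt X j ^+ 2 = 1;
  inv_lev : forall s, (s < K)%N -> slot X s = s ->
    \sum_(j < K | slot X j == s) wt X j ^+ 2 * eta j = lev X s;
  inv_orth : forall i s, (i < cnt X)%N ->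
    \sum_(j < K | slot X j == s) row X i j * wt X j = 0;
  inv_rows : forall i i', (i < cnt X)%N -> (i' < cnt X)%N ->
    \sum_(j < K) row X i j * row X i' j = (i == i')%:R;
  inv_diag : forall i, (i < cnt X)%N ->
    \sum_(j < K) row X i j ^+ 2 * eta j = xi i;
  inv_col : forall j, \sum_(i < cnt X) row X i j ^+ 2 + wt X j ^+ 2 = 1;
  inv_idem : forall j, slot X (slot X j) = slot X j }.

Lemma ortho_inv_S (X : state) (K : nat) : ortho_inv X K -> ortho_inv X K.+1.
Proof.
move=> [so sl wo lo ro nm lv og rw dg cl idm].
have sK : slot X K = K by apply: so.
have empty (F : nat -> R) : \sum_(j < K | slot X j == K) F j = 0.
  apply: big1 => j /eqP jK; have := sl j (ltn_ord j); by rewrite jK ltnn.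
split=> //.
- by move=> j /ltnW; apply: so.
- move=> j; rewrite ltnS leq_eqVlt => /orP[/eqP->|/sl/ltnW//]; by rewrite sK.
- by move=> j /ltnW; apply: wo.
- by move=> j /ltnW; apply: lo.
- by move=> i j iX /ltnW; apply: ro.
- move=> s; rewrite ltnS leq_eqVlt.
  rewrite (sum_cond_recr _ (fun j => slot X j == s) (fun j => wt X j ^+ 2)).
  move=> /orP[/eqP-> _|sltK ss].
    by rewrite (empty (fun j => wt X j ^+ 2)) sK eqxx wo// expr1n add0r.
  by rewrite nm// sK gtn_eqF// addr0.
- move=> s; rewrite ltnS leq_eqVlt.
  rewrite (sum_cond_recr _ (fun j => slot X j == s) (fun j => wt X j ^+ 2 * eta j)).
  move=> /orP[/eqP-> _|sltK ss].
    by rewrite (empty (fun j => wt X j ^+ 2 * eta j)) sK eqxx wo// expr1n add0r mul1r lo.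
  by rewrite lv// sK gtn_eqF// addr0.
- move=> i s iX; rewrite (sum_cond_recr _ (fun j => slot X j == s) (fun j => row X i j * wt X j)).
  by rewrite og// ro// mul0r add0r; case: ifP.
- by move=> i i' iX i'X; rewrite big_ord_recr /= rw// ro// mul0r addr0.
- by move=> i iX; rewrite big_ord_recr /= dg// ro// expr0n mul0r addr0.
Qed.

Lemma ortho_inv_le (X : state) (K L : nat) :
  (K <= L)%N -> ortho_inv X K -> ortho_inv X L.
Proof.
move=> KL iK; rewrite -(subnKC KL); elim: (L - K)%N => [|m IH]; first by rewrite addn0.
by rewrite addnS; apply: ortho_inv_S.
Qed.

(** With [v_p], [v_q] the two vectors, the new row is [c v_p + d v_q] and the name [q] passes to
    [- d v_p + c v_q]; as supports are disjoint, this only rescales [wt]. The new level comes from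
    invariance of the trace. *)
Definition rotate (X : state) (p q : nat) (c d : R) : state :=
  State (cnt X).+1
    (fun i j => if i == cnt X then
       (if slot X j == p then c * wt X j
        else if slot X j == q then d * wt X j else 0) else row X i j)
    (fun j => if slot X j == p then q else slot X j)
    (fun j => if slot X j == p then - d * wt X j
              else if slot X j == q then c * wt X j else wt X j)
    (fun s => if s == q then lev X p + lev X q - xi (cnt X) else lev X s)
    (rem p (act X)) (fresh X).

Lemma rotate_ortho (X : state) (K p q : nat) (c d : R) : ortho_inv X K ->
  (p < K)%N -> (q < K)%N -> p != q -> slot X p = p -> slot X q = q ->
  c ^+ 2 + d ^+ 2 = 1 -> c ^+ 2 * lev X p + d ^+ 2 * lev X q = xi (cnt X) ->
  ortho_inv (rotate X p q c d) K.
Proof.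
move=> [so sl wo lo ro nm lv og rw dg cl idm] pK qK pq sp sq cd1 cdx.
have qp : (q == p) = false by rewrite eq_sym (negbTE pq).
set n := cnt X.
(* The next three identities describe the sums after the rotation: the new row lives on the supports
   of [p] and [q], the support of [q] absorbs that of [p], the others are unchanged. *)
have sum_new (G : nat -> R) :
    \sum_(j < K) row (rotate X p q c d) n j * G j =
    c * \sum_(j < K | slot X j == p) wt X j * G j +
    d * \sum_(j < K | slot X j == q) wt X j * G j.
  rewrite /= eqxx (bigID (fun j : 'I_K => slot X j == p)) /= !mulr_sumr; congr (_ + _).
    by apply: eq_bigr => j ->; rewrite mulrA.
  rewrite (bigID (fun j : 'I_K => slot X j == q)) /= addrC big1 ?add0r.
    apply: eq_big => [j|j /andP[/negbTE-> ->]]; last by rewrite mulrA.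
    by case: (slot X j =P q) => [->|]; rewrite ?qp ?andbF.
  by move=> j /andP[/negbTE-> /negbTE->]; rewrite mul0r.
have sum_q (G : nat -> R) :
    \sum_(j < K | (if slot X j == p then q else slot X j) == q) G j =
    \sum_(j < K | slot X j == p) G j + \sum_(j < K | slot X j == q) G j.
  rewrite (bigID (fun j : 'I_K => slot X j == p)) /=; congr (_ + _).
    by apply: eq_bigl => j; case: ifP; rewrite ?eqxx ?andbF.
  apply: eq_bigl => j; case: (slot X j =P p) => [->|]; rewrite ?andbF ?andbT//.
  by rewrite (negbTE pq).
have sum_s s (F G : nat -> R) : s != q -> s != p ->
    (forall j, slot X j = s -> F j = G j) ->
    \sum_(j < K | (if slot X j == p then q else slot X j) == s) F j =
    \sum_(j < K | slot X j == s) G j.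
  move=> sq' sp' FG; apply: eq_big => [j|j].
    case: (slot X j =P p) => [->|//]; by rewrite eq_sym (negbTE sq') eq_sym (negbTE sp').
  case: ifP => [_|_ /eqP/FG//]; by rewrite eq_sym (negbTE sq').
have wE s j : s != q -> s != p -> slot X j = s -> wt (rotate X p q c d) j = wt X j.
  by move=> /negbTE h /negbTE h' /= ->; rewrite h h'.
have nlt i : (i < n.+1)%N -> i = n \/ (i < n)%N /\ (i == n) = false.
  by rewrite ltnS leq_eqVlt => /orP[/eqP|h]; [left|right; rewrite h ltn_eqF].
split.
- move=> j Kj /=; rewrite so// gtn_eqF//; exact: leq_trans Kj.
- by move=> j jK /=; case: ifP => // _; apply: sl.
- by move=> j Kj /=; rewrite so// !gtn_eqF ?wo//; exact: leq_trans Kj.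
- by move=> j Kj /=; rewrite gtn_eqF ?lo//; exact: leq_trans Kj.
- move=> i j /nlt[->|[iX ne]] Kj /=; rewrite ?eqxx ?ne; last exact: ro.
  by rewrite so// !gtn_eqF//; exact: leq_trans Kj.
- move=> s sK /=; have [->|sq'] := eqVneq s q.
    move=> _; rewrite (sum_q (fun j => (if slot X j == p then - d * wt X j
      else if slot X j == q then c * wt X j else wt X j) ^+ 2)).
    rewrite (eq_bigr (fun j : 'I_K => d ^+ 2 * wt X j ^+ 2)); last first.
      by move=> j ->; rewrite exprMn sqrrN.
    rewrite -mulr_sumr nm//.
    rewrite (eq_bigr (fun j : 'I_K => c ^+ 2 * wt X j ^+ 2)); last first.
      by move=> j /eqP->; rewrite qp eqxx exprMn.
    by rewrite -mulr_sumr nm// !mulr1 addrC.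
  have [->|spn] := eqVneq s p; first by rewrite sp eqxx => e; rewrite e eqxx in pq.
  case: ifP => [_ e|_ ss]; first by rewrite e eqxx in sq'.
  rewrite -(nm s)//; apply: (sum_s s (fun j => wt (rotate X p q c d) j ^+ 2)
    (fun j => wt X j ^+ 2)) => // j js; by rewrite (wE s).
- move=> s sK /=; have [->|sq'] := eqVneq s q.
    move=> _; rewrite (sum_q (fun j => (if slot X j == p then - d * wt X j
      else if slot X j == q then c * wt X j else wt X j) ^+ 2 * eta j)).
    rewrite (eq_bigr (fun j : 'I_K => d ^+ 2 * (wt X j ^+ 2 * eta j))); last first.
      by move=> j ->; rewrite exprMn sqrrN mulrA.
    rewrite -mulr_sumr lv//.
    rewrite (eq_bigr (fun j : 'I_K => c ^+ 2 * (wt X j ^+ 2 * eta j))); last first.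
      by move=> j /eqP->; rewrite qp eqxx exprMn mulrA.
    rewrite -mulr_sumr lv// -cdx; have -> : d ^+ 2 = 1 - c ^+ 2 by rewrite -cd1 addrAC subrr add0r.
    ring.
  have [->|spn] := eqVneq s p; first by rewrite sp eqxx => e; rewrite e eqxx in pq.
  case: ifP => [_ e|_ ss]; first by rewrite e eqxx in sq'.
  rewrite -(lv s)//; apply: (sum_s s (fun j => wt (rotate X p q c d) j ^+ 2 * eta j)
    (fun j => wt X j ^+ 2 * eta j)) => // j js; by rewrite (wE s).
- move=> i s iX; have [->|sq'] := eqVneq s q; last first.
    (* For [s = p] the sum is empty: no column keeps slot [p]. *)
    have [->|spn] := eqVneq s p.
      apply: big1 => j /=; case: ifP => [_|/negP h /eqP/esym e].
        by rewrite (negbTE pq) || rewrite qp.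
      by case: h; apply/eqP.
    case: (nlt _ iX) => [->|[i_n ne]].
      rewrite (sum_s s (fun j => row (rotate X p q c d) n j * wt (rotate X p q c d) j)
        (fun _ => 0))//; first exact: big1.
      by move=> j js /=; rewrite eqxx js (negbTE spn) (negbTE sq') mul0r.
    rewrite (sum_s s (fun j => row (rotate X p q c d) i j * wt (rotate X p q c d) j)
      (fun j => row X i j * wt X j))//; first exact: og.
    by move=> j js; rewrite (wE s)//= ne.
  rewrite (sum_q (fun j => row (rotate X p q c d) i j * wt (rotate X p q c d) j)).
  case: (nlt _ iX) => [->|[i_n ne]].
    rewrite (eq_bigr (fun j : 'I_K => (- c * d) * wt X j ^+ 2)); last first.
      by move=> j js /=; rewrite eqxx js; ring.
    rewrite -mulr_sumr nm//.
    rewrite (eq_bigr (fun j : 'I_K => (c * d) * wt X j ^+ 2)); last first.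
      by move=> j /eqP js /=; rewrite eqxx js qp eqxx; ring.
    rewrite -mulr_sumr nm//; ring.
  rewrite (eq_bigr (fun j : 'I_K => (- d) * (row X i j * wt X j))); last first.
    by move=> j js /=; rewrite js ne; ring.
  rewrite -mulr_sumr og//.
  rewrite (eq_bigr (fun j : 'I_K => c * (row X i j * wt X j))); last first.
    by move=> j /eqP js /=; rewrite js qp eqxx ne; ring.
  by rewrite -mulr_sumr og//; ring.
- have key i : (i < n)%N -> \sum_(j < K) row (rotate X p q c d) n j * row X i j = 0.
    move=> i_n; rewrite sum_new.
    have e s : \sum_(j < K | slot X j == s) wt X j * row X i j = 0.
      by apply: etrans (og i s i_n); apply: eq_bigr => j _; rewrite mulrC.
    by rewrite !e !mulr0 addr0.
  have rE i j : (i == n) = false -> row (rotate X p q c d) i j = row X i j by move=> /= ->.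
  move=> i i' /nlt[->|[iX ne]] /nlt[->|[i'X ne']].
  + rewrite sum_new eqxx.
    rewrite (eq_bigr (fun j : 'I_K => c * wt X j ^+ 2)); last first.
      by move=> j js /=; rewrite eqxx js; ring.
    rewrite -mulr_sumr nm//.
    rewrite (eq_bigr (fun j : 'I_K => d * wt X j ^+ 2)); last first.
      by move=> j /eqP js /=; rewrite eqxx js qp eqxx; ring.
    by rewrite -mulr_sumr nm// !mulr1 -!expr2 cd1.
  + rewrite eq_sym ne'; apply: etrans (key i' i'X).
    by apply: eq_bigr => j _; rewrite [row _ i' _]rE.
  + rewrite ne; apply: etrans (key i iX); apply: eq_bigr => j _; by rewrite [row _ i _]rE// mulrC.
  + rewrite -(rw i i' iX i'X). apply: eq_bigr => j _; by rewrite !rE.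
- move=> i /nlt[->|[iX ne]] /=; last first.
    by rewrite ne; exact: dg.
  under eq_bigr => j _ do rewrite expr2 -mulrA.
  rewrite (sum_new (fun j => row (rotate X p q c d) n j * eta j)).
  rewrite (eq_bigr (fun j : 'I_K => c * (wt X j ^+ 2 * eta j))); last first.
    by move=> j js /=; rewrite eqxx js; ring.
  rewrite -mulr_sumr lv//.
  rewrite (eq_bigr (fun j : 'I_K => d * (wt X j ^+ 2 * eta j))); last first.
    by move=> j /eqP js /=; rewrite eqxx js qp eqxx; ring.
  by rewrite -mulr_sumr lv// -cdx; ring.
- move=> j; rewrite /= big_ord_recr /= eqxx.
  have -> : \sum_(i < cnt X) (if i == cnt X :> nat then
       (if slot X j == p then c * wt X j
        else if slot X j == q then d * wt X j else 0) else row X i j) ^+ 2 =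
     \sum_(i < cnt X) row X i j ^+ 2.
    by apply: eq_bigr => i _; rewrite ltn_eqF.
  rewrite -[RHS](cl j) -addrA; congr (_ + _).
  case: ifP => _; first by rewrite !exprMn sqrrN -mulrDl cd1 mul1r.
  case: ifP => _; first by rewrite !exprMn -mulrDl [d ^+ 2 + _]addrC cd1 mul1r.
  by rewrite expr0n add0r.
- move=> j /=; have [jp|jp] := eqVneq (slot X j) p; first by rewrite sq qp.
  by rewrite idm (negbTE jp).
Qed.


(** * The greedy construction *)

Definition take_fresh (X : state) (k : nat) : state :=
  State (cnt X) (row X) (slot X) (wt X) (lev X) (fresh X k :: act X)
    (fun i => fresh X (if (i < k)%N then i else i.+1)).

Definition excess (X : state) (l : nat) : R :=
  \sum_(s <- act X) lev X s + \sum_(i < l) eta (fresh X i)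
  - \sum_(i < size (act X) + l) xi (cnt X + i).

Record wf (X : state) : Prop := Wf {
  wf_ortho : exists K, ortho_inv X K;
  wf_uniq : uniq (act X);
  wf_slot : {in act X, forall s, slot X s = s};
  wf_lev : {in act X, forall s, 0 <= lev X s};
  wf_mono : forall i j, (i < j)%N -> (fresh X i < fresh X j)%N;
  wf_fresh : forall i, [/\ fresh X i \notin act X,
    slot X (fresh X i) = fresh X i & lev X (fresh X i) = eta (fresh X i)];
  wf_cover : forall j, slot X j \in act X \/ exists i, j = fresh X i }.

Record good (X : state) : Prop := Good {
  good_wf : wf X;
  good_low : {in act X &, forall s s', lev X s < xi (cnt X) ->
    lev X s' < xi (cnt X) -> s = s'};
  good_maj : forall l, 0 <= excess X l }.

(** Makes each row stationary along the construction; the last clause lets a column, once reached,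
    be followed from one pending vector to the next. *)
Definition extends (X X' : state) : Prop :=
  [/\ (cnt X <= cnt X')%N,
      forall i j, (i < cnt X)%N -> row X' i j = row X i j
    & forall j, slot X j \in act X -> slot X' j \in act X'].

Lemma extends_trans Y X Z : extends X Y -> extends Y Z -> extends X Z.
Proof.
move=> [n1 r1 s1] [n2 r2 s2]; split.
- exact: leq_trans n1 n2.
- by move=> i j iX; rewrite r2 ?r1// (leq_trans iX).
- by move=> j /s1/s2.
Qed.

Hypothesis xi_gt0 : forall n, 0 < xi n.
Hypothesis xi_mono : forall m n, (m <= n)%N -> xi n <= xi m.
Hypothesis xi_small : forall e : R, 0 < e -> exists n, xi n <= e.
Hypothesis xi_unbounded : forall B : R, exists r, B < \sum_(i < r) xi i.
Hypothesis eta_gt0 : forall n, 0 < eta n.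
Hypothesis eta_small : forall e : R, 0 < e ->
  exists N, forall n, (N <= n)%N -> eta n <= e.

Lemma fresh_ge X : wf X -> forall i, (i <= fresh X i)%N.
Proof.
move=> w; elim=> // i IH; exact: leq_ltn_trans IH (wf_mono w (ltnSn i)).
Qed.

Lemma fresh_small X (e : R) : wf X -> 0 < e -> exists k, eta (fresh X k) <= e.
Proof.
by move=> w /eta_small[N hN]; exists N; apply: hN; apply: fresh_ge.
Qed.

Lemma wf_take_fresh X k : wf X -> wf (take_fresh X k).
Proof.
move=> w; have [[K iK] u sl lv mo fr cv] := w.
have inj i : fresh X i == fresh X k -> i = k.
  by case: (ltngtP i k) => // /mo; case: ltngtP.
split=> //=.
- by exists K; case: iK => *; split.
- by have [-> _ _] := fr k.
- by move=> s; rewrite inE => /predU1P[->|/sl//]; have [] := fr k.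
- by move=> s; rewrite inE => /predU1P[->|/lv//]; have [_ _ ->] := fr k; exact: ltW.
- by move=> i j ij; apply: mo; do 2 case: ifP; lia.
- move=> i; set i' := if _ then _ else _; have [nx sx lx] := fr i'; split=> //.
  rewrite inE (negbTE nx) orbF; apply/negP => /inj; rewrite /i'; case: ifP; lia.
- move=> j; rewrite inE; have [->|[i ->]] := cv j; first by rewrite orbT; left.
  case: (ltngtP i k) => [ik|ki|->]; last by have [_ -> _] := fr k; rewrite eqxx; left.
    by right; exists i; rewrite ik.
  by right; exists i.-1; case: ifP => h; congr (fresh X _); lia.
Qed.

Lemma wf_rotate X p q : wf X -> p \in act X -> q \in act X -> p != q ->
  lev X q <= xi (cnt X) -> xi (cnt X) <= lev X p ->
  exists c d, wf (rotate X p q c d).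
Proof.
move=> w pX qX pq lq lp; have [[K0 iK0] u sl lv mo fr cv] := w.
pose K := maxn K0 (maxn p.+1 q.+1).
have iK : ortho_inv X K by apply: ortho_inv_le iK0; rewrite /K leq_maxl.
have [c [d [cd1 cdx]]] := convex_squares lq lp; exists c, d.
split=> /=.
- exists K; apply: rotate_ortho => //; rewrite /K ?sl//; lia.
- exact: rem_uniq.
- by move=> s; rewrite mem_rem_uniq// inE => /andP[/negbTE sp /sl->]; rewrite sp.
- move=> s; rewrite mem_rem_uniq// inE => /andP[_ /lv s0]; case: ifP => // _.
  by rewrite addrAC addr_ge0 ?subr_ge0// lv.
- exact: mo.
- move=> i; have [nx sx lx] := fr i; split.
  + by apply: contra nx => /mem_rem.
  + by rewrite sx; case: eqP => // e; rewrite e pX in nx.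
  + by case: eqP => // e; rewrite e qX in nx.
- move=> j; have [sx|] := cv j; last by right.
  left; rewrite mem_rem_uniq// inE; case: ifP => [_|->//].
  by rewrite eq_sym pq qX.
Qed.

(** If the vector taken is among the first [l.+1] fresh ones, nothing but the index changes;
    otherwise it comes on top of the first [l], along with one more term of [xi]. *)
Lemma excess_take_fresh X k l : wf X -> excess (take_fresh X k) l =
  if (k <= l)%N then excess X l.+1
  else excess X l + eta (fresh X k) - xi (cnt X + (size (act X) + l)).
Proof.
move=> w; have [_ _ lk] := wf_fresh w k.
rewrite /excess /= big_cons addSn lk.
case: leqP => [kl|ll].
  by rewrite -addnS -(sum_skip (fun i => eta (fresh X i)) kl); ring.
rewrite (eq_bigr (fun i : 'I_l => eta (fresh X i))); last first.
  by move=> i _; rewrite (ltn_trans (ltn_ord i) ll).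
rewrite big_ord_recr /=; ring.
Qed.

(** The two levels keep their sum, and the retired value [xi (cnt X)] leaves together with the
    matching term of [xi]. *)
Lemma excess_rotate X p q c d l : uniq (act X) ->
  p \in act X -> q \in act X -> p != q ->
  excess (rotate X p q c d) l = excess X l.
Proof.
move=> u pX qX pq; rewrite /excess /=.
have qr : q \in rem p (act X) by rewrite mem_rem_uniq// inE eq_sym pq.
have sz : size (act X) = (size (rem p (act X))).+1.
  by rewrite size_rem// prednK//; case: (act X) pX.
rewrite sz addSn big_ord_recl /= addn0.
rewrite (big_rem p pX) /= !(big_rem q qr) /= eqxx.
rewrite (eq_big_seq (fun s => lev X s)); last first.
  by move=> s; rewrite mem_rem_uniq ?rem_uniq// inE => /andP[/negbTE->].
rewrite (eq_bigr (fun i : 'I_(size (rem p (act X)) + l) => xi (cnt X + bump 0 i))).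
  ring.
by move=> i _; rewrite /bump /= addnCA add1n addSn.
Qed.

Lemma rotate_extends X p q c d : wf X -> p \in act X -> q \in act X -> p != q ->
  extends X (rotate X p q c d).
Proof.
move=> w pX qX pq; split=> //=.
- by move=> i j iX; rewrite ltn_eqF.
- move=> j jX; rewrite mem_rem_uniq ?(wf_uniq w)// inE.
  by case: ifP => [_|->//]; rewrite eq_sym pq.
Qed.

(** Subtract [xi (cnt X)] from every pending level: the differences sum to at most [excess X 0], as
    later terms of [xi] are no larger, and by [good_low] at most one is negative, by at most
    [xi (cnt X)]. *)
Lemma lev_bound X s : good X -> s \in act X ->
  lev X s <= excess X 0 + xi (cnt X) *+ 2.
Proof.
move=> [w low maj] sX; set x := xi (cnt X).
have x0 : 0 < x by exact: xi_gt0.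
have D0 := maj 0%N.
have [lx|xl] := ltP (lev X s) x; first by rewrite mulr2n; lra.
have ex : \sum_(t <- act X) (lev X t - x) <= excess X 0.
  rewrite /excess big_ord0 addr0 addn0 sumrB lerB//.
  rewrite big_const_seq count_predT iter_addr_0 -[X in _ *+ X]card_ord -sumr_const.
  by apply: ler_sum => i _; apply: xi_mono; rewrite leq_addr.
suff h : - x <= \sum_(t <- rem s (act X)) (lev X t - x).
  by move: ex; rewrite (big_rem s sX) /= mulr2n; lra.
have u := rem_uniq s (wf_uniq w).
have [[e eX le]|none] := pselect (exists2 e, e \in rem s (act X) & lev X e < x).
  rewrite (big_rem e eX) /=; have e0 := wf_lev w (mem_rem eX).
  suff : 0 <= \sum_(y <- rem e (rem s (act X))) (lev X y - x) by lra.
  rewrite big_seq sumr_ge0// => t; rewrite mem_rem_uniq// inE => /andP[te tX].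
  rewrite subr_ge0 leNgt; apply/negP => lt; move/eqP: te; apply.
  exact: low (mem_rem tX) (mem_rem eX) lt le.
apply: (@le_trans _ _ 0); first by rewrite oppr_le0 ltW.
rewrite big_seq sumr_ge0// => t tX; rewrite subr_ge0 leNgt; apply/negP => lt.
by apply: none; exists t.
Qed.

(** [e] is not the only pending vector, since [excess X 0] would be negative; any other one is at or
    above [xi (cnt X)] and can be rotated with [e]. The result is again named [e], which stays the
    only possible low name. *)
Lemma step_low X e : good X -> e \in act X -> lev X e < xi (cnt X) ->
  exists X', [/\ good X', extends X X', cnt X' = (cnt X).+1,
    size (act X) = (size (act X')).+1 &
    excess X' =1 excess X /\ fresh X' = fresh X].
Proof.
move=> [w low maj] eX le.
have [p pr] : exists p, p \in rem e (act X).
  case E : (rem e (act X)) => [|p r]; last by exists p; rewrite inE eqxx.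
  have sz := size_rem eX; rewrite E /= in sz.
  have := maj 0%N; rewrite /excess big_ord0 addr0 addn0 (big_rem e eX) /= E big_nil addr0.
  have -> : size (act X) = 1%N by case: (act X) eX sz => // a [].
  by rewrite big_ord1 addn0 subr_ge0 leNgt le.
move: pr; rewrite mem_rem_uniq ?(wf_uniq w)// inE => /andP[pe pX].
have lp : xi (cnt X) <= lev X p.
  by rewrite leNgt; apply/negP => lp; move/eqP: pe; apply; exact: low.
have [c [d w']] := wf_rotate w pX eX pe (ltW le) lp.
exists (rotate X p e c d); split=> //.
- split=> // [s s'|l]; last by rewrite excess_rotate// (wf_uniq w).
  have isE t : t \in rem p (act X) ->
      (if t == e then lev X p + lev X e - xi (cnt X) else lev X t) < xi (cnt X).+1 -> t = e.
    move=> tX; case: eqP => // te lt; apply: low => //; first exact: mem_rem tX.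
    by apply: lt_le_trans lt _; apply: xi_mono.
  by move=> sX s'X /(isE _ sX)-> /(isE _ s'X)->.
- exact: rotate_extends.
- by rewrite /= size_rem// prednK//; case: (act X) pX.
- by split=> // l; rewrite excess_rotate// (wf_uniq w).
Qed.

Lemma good_take_fresh X : good X ->
  (forall e, e \in act X -> xi (cnt X) <= lev X e) -> good (take_fresh X 0).
Proof.
move=> [w low maj] none; split; first exact: wf_take_fresh.
  move=> s s' /=; rewrite !inE => /predU1P[->|/none h] /predU1P[->|/none h'] //.
  - by move=> _; rewrite ltNge h'.
  - by rewrite ltNge h.
  - by rewrite ltNge h.
by move=> l; rewrite excess_take_fresh// leq0n.
Qed.

(** Each [step_low] removes a pending vector, so after finitely many none is low, and admitting the
    first fresh vector cannot create two low ones. *)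
Lemma consume X : good X -> exists X', [/\ good X', extends X X',
  forall l, excess X' l = excess X l.+1,
  forall i, fresh X' i = fresh X i.+1 & slot X' (fresh X 0) \in act X'].
Proof.
have [m] := ubnP (size (act X)); elim: m X => // m IH X.
rewrite ltnS => sm gX.
have [[e eX le]|none] := pselect (exists2 e, e \in act X & lev X e < xi (cnt X)).
  have [Y [gY XY cY sY [dY fY]]] := step_low gX eX le.
  have [|Z [gZ YZ dZ fZ tZ]] := IH Y _ gY; first by rewrite -sY.
  exists Z; split=> //; first exact: extends_trans YZ.
  - by move=> l; rewrite dZ dY.
  - by move=> i; rewrite fZ fY.
  - by rewrite -fY.
exists (take_fresh X 0); split=> //.
- apply: good_take_fresh => // e eX; rewrite leNgt; apply/negP => le.
  by apply: none; exists e.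
- by split=> //= j jX; rewrite inE jX orbT.
- by move=> l; rewrite excess_take_fresh//; exact: good_wf.
- by have [_ -> _] := wf_fresh (good_wf gX) 0; rewrite inE eqxx.
Qed.

Lemma consume_many X l : good X -> exists X',
  [/\ good X', extends X X' & excess X' 0 = excess X l].
Proof.
elim: l X => [|l IH] X gX; first by exists X; split=> //.
have [Y [gY XY dY _ _]] := consume gX; have [Z [gZ YZ dZ]] := IH _ gY.
exists Z; split=> //; first exact: extends_trans YZ.
by rewrite dZ dY.
Qed.

Lemma touch X j : good X -> exists X',
  [/\ good X', extends X X' & slot X' j \in act X'].
Proof.
move=> gX; have [jX|[i ->]] := wf_cover (good_wf gX) j.
  by exists X; split=> //.
elim: i X gX => [|i IH] X gX; have [Y [gY XY _ fY tY]] := consume gX.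
  by exists Y.
have [Z [gZ YZ tZ]] := IH _ gY; exists Z; split=> //; first exact: extends_trans YZ.
by rewrite -fY.
Qed.

Lemma advance X : good X -> exists X',
  [/\ good X', extends X X' & (cnt X < cnt X')%N].
Proof.
move=> gX; have [l hl] : exists l, eta (fresh X l) < xi (cnt X).
  have [|l hl] := @fresh_small X (xi (cnt X) / 2) (good_wf gX).
    by rewrite divr_gt0.
  by exists l; have := xi_gt0 (cnt X); lra.
elim: l X gX hl => [|l IH] X gX hl.
all: have [[e eX le]|none] := pselect (exists2 e, e \in act X & lev X e < xi (cnt X)).
1,3: by have [Y [gY XY cY _ _]] := step_low gX eX le; exists Y; rewrite cY.
all: have g1 : good (take_fresh X 0) by apply: good_take_fresh => // e eX;
  rewrite leNgt; apply/negP => le; apply: none; exists e.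
all: have X1 : extends X (take_fresh X 0) by split=> //= j jX; rewrite inE jX orbT.
  have [|/=|Y [gY XY cY _ _]] := @step_low _ (fresh X 0) g1; first by rewrite inE eqxx.
    by have [_ _ ->] := wf_fresh (good_wf gX) 0.
  by exists Y; rewrite cY; split=> //; apply: extends_trans XY.
have [//|Y [gY XY cY]] := IH _ g1; exists Y; split=> //.
exact: extends_trans XY.
Qed.

Lemma reach_small X (e : R) : 0 < e -> good X -> exists X',
  [/\ good X', extends X X' & xi (cnt X') <= e].
Proof.
move=> e0 gX; have [n hn] := xi_small e0.
suff [Y [gY XY nY]] : exists Y, [/\ good Y, extends X Y & (n <= cnt Y)%N].
  by exists Y; split=> //; apply: le_trans hn; apply: xi_mono.
elim: {hn} n => [|n [Y [gY XY nY]]]; first by exists X; split=> //.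
have [Z [gZ YZ nZ]] := advance gY; exists Z; split=> //.
  exact: extends_trans YZ.
exact: leq_ltn_trans nZ.
Qed.

(* A fresh vector of very small level lowers the level of [slot X j] by almost
   [xi (cnt X)]; this keeps all excesses nonnegative since each drops by at most
   [xi (cnt X)]. *)
Lemma far_step X j : good X -> slot X j \in act X ->
  (forall l, xi (cnt X) <= excess X l) -> xi (cnt X) *+ 2 <= lev X (slot X j) ->
  exists X', [/\ good X', extends X X', cnt X' = (cnt X).+1 &
    lev X' (slot X' j) <= lev X (slot X j) - xi (cnt X) / 2].
Proof.
move=> gX jX exc big; have [w low maj] := gX; have x0 := xi_gt0 (cnt X).
have [|k hk] := @fresh_small X (xi (cnt X) / 2) w; first by rewrite divr_gt0.
set p := slot X j in jX big *; set q := fresh X k.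
have [qX sq lq] := wf_fresh w k; rewrite -/q in hk qX sq lq.
pose Y := take_fresh X k; have wY : wf Y by exact: wf_take_fresh.
have pY : p \in act Y by rewrite inE jX orbT.
have qY : q \in act Y by rewrite inE eqxx.
have pq : p != q by apply: contraNneq qX => <-.
have lqx : lev Y q <= xi (cnt Y) by rewrite /= lq; lra.
have lpx : xi (cnt Y) <= lev Y p by rewrite /=; move: big; rewrite mulr2n; lra.
have [c [d w']] := wf_rotate wY pY qY pq lqx lpx.
have XY : extends X Y by split=> //= i iX; rewrite inE iX orbT.
have x1 : xi (cnt X).+1 <= xi (cnt X) by apply: xi_mono.
have q0 : 0 < eta q by exact: eta_gt0.
exists (rotate Y p q c d); split=> //.
- split=> // [s s'|l].
    (* The rotated vector, now named [q], stays above [xi (cnt X)], so every low vector is an old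
       one that was already low. *)
    have isL t : t \in act (rotate Y p q c d) ->
        lev (rotate Y p q c d) t < xi (cnt X).+1 -> t \in act X /\ lev X t < xi (cnt X).
      rewrite mem_rem_uniq ?(wf_uniq wY)// inE => /andP[_ /=].
      rewrite inE => /predU1P[->|tX].
        by rewrite eqxx lq; move: big; rewrite mulr2n; lra.
      by case: eqP => [e|_ lt]; [by rewrite -e tX in qX | split=> //; lra].
    by move=> sX s'X /(isL _ sX)[? ?] /(isL _ s'X)[? ?]; apply: low.
  rewrite excess_rotate ?(wf_uniq wY)// excess_take_fresh//; case: ifP => // _.
  have := exc l; have : xi (cnt X + (size (act X) + l)) <= xi (cnt X).
    by apply: xi_mono; rewrite leq_addr.
  by rewrite -/q; lra.
- exact: extends_trans (rotate_extends c d wY pY qY pq).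
- by rewrite /= -/p eqxx eqxx lq; lra.
Qed.

(** Induction on a number [r] of far steps that would exhaust the level; it stops earlier if some
    excess falls below the current term of [xi]. *)
Lemma lower_level X j (e : R) : good X -> slot X j \in act X ->
  xi (cnt X) *+ 3 <= e -> exists X',
  [/\ good X', extends X X' & lev X' (slot X' j) <= e].
Proof.
move=> gX jX xe.
have [r hr] : exists r, lev X (slot X j) <= \sum_(i < r) xi (cnt X + i) / 2.
  (* Doubling the level makes up for the halves; the terms before [cnt X] are added because the sum
     to be bounded starts there. *)
  have [r hr] := xi_unbounded (lev X (slot X j) *+ 2 + \sum_(i < cnt X) xi i).
  exists r; rewrite -mulr_suml.
  have : \sum_(i < r) xi i <= \sum_(i < cnt X + r) xi i.
    by rewrite addnC big_split_ord /= lerDl sumr_ge0// => i _; exact: ltW.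
  rewrite big_split_ord /=; move: hr; rewrite mulr2n; lra.
elim: r X gX jX xe hr => [|r IH] X gX jX xe hr.
  rewrite big_ord0 in hr; exists X; split=> //.
  apply: le_trans hr _; apply: le_trans xe; by rewrite mulrn_wge0// ltW.
have [le|lt] := leP (lev X (slot X j)) e.
  by exists X; split=> //.
have [[l hl]|none] := pselect (exists l, excess X l < xi (cnt X)).
  have [Y [gY XY dY]] := consume_many l gX; exists Y; split=> //.
  (* The excess contributes at most [xi (cnt X)] and [lev_bound] adds twice [xi (cnt Y)]: hence the
     factor 3. *)
  have [nXY _ tXY] := XY; have := lev_bound gY (tXY _ jX); rewrite dY.
  have := xi_mono nXY; move: xe; rewrite !mulrS mulr0n; lra.
have [||Y [gY XY nY lY]] := far_step gX jX.
- by move=> l; rewrite leNgt; apply/negP => hl; apply: none; exists l.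
- by have := xi_gt0 (cnt X); move: xe lt; rewrite !mulrS mulr0n; lra.
have [_ _ tXY] := XY.
have [|||Z [gZ YZ lZ]] := IH _ gY.
- exact: tXY.
- by apply: le_trans xe; rewrite lerMn2r /= nY; apply: xi_mono.
- apply: le_trans lY _; move: hr; rewrite big_ord_recl addn0 nY /=.
  have -> : \sum_(i < r) xi (cnt X + bump 0 i) / 2 = \sum_(i < r) xi ((cnt X).+1 + i) / 2.
    by apply: eq_bigr => i _; rewrite /bump addnCA add1n addSn.
  lra.
by exists Z; split=> //; exact: extends_trans YZ.
Qed.

Lemma approach X j (e : R) : 0 < e -> good X -> exists X',
  [/\ good X', extends X X', lev X' (slot X' j) <= e & xi (cnt X') <= e].
Proof.
move=> e0 gX.
have [Y [gY XY tY]] := touch j gX.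
have [|Z [gZ YZ eZ]] := @reach_small Y (e / 3) _ gY; first by rewrite divr_gt0.
have [_ _ tYZ] := YZ.
have [|T [gT ZT lT]] := @lower_level Z j e gZ (tYZ _ tY).
  by move: eZ; rewrite -mulr_natl; lra.
exists T; split=> //; first exact: extends_trans XY (extends_trans YZ ZT).
have [nZT _ _] := ZT; have := xi_mono nZT; have := xi_gt0 (cnt T); lra.
Qed.


(** The level is a sum of nonnegative terms over the support; this is the term of [j]. *)
Lemma wt_le_lev X j : wf X -> wt X j ^+ 2 * eta j <= lev X (slot X j).
Proof.
move=> [[K0 iK0] _ _ _ _ _ _]; pose K := maxn K0 j.+1.
have iK : ortho_inv X K by apply: ortho_inv_le iK0; exact: leq_maxl.
have jK : (j < K)%N by rewrite /K leq_max ltnSn orbT.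
rewrite -(inv_lev iK (inv_slot_lt iK jK) (inv_idem iK j)).
rewrite (bigD1 (Ordinal jK)) //= lerDl sumr_ge0// => i _.
by rewrite mulr_ge0 ?sqr_ge0// ltW.
Qed.

(** * Passage to the limit *)

Hypothesis xi_eta : forall n, \sum_(j < n) xi j <= \sum_(j < n) eta j.

Definition init_state : state :=
  State 0 (fun _ _ => 0) id (fun=> 1) eta [::] id.

Lemma init_good : good init_state.
Proof.
split.
- split=> //=; last by move=> j; right; exists j.
  by exists 0%N; split=> //= j; rewrite big_ord0 expr1n add0r.
- by move=> s.
- by move=> l; rewrite /excess /= big_nil add0r add0n subr_ge0; exact: xi_eta.
Qed.

(** Stage [k.+1] serves the pair [(j, m)] coded by [k], with tolerance [1 / (m + 1)]; so every
    column is served with every tolerance. *)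
Lemma good_sequence : exists X : nat -> state,
  [/\ forall k, good (X k), forall k l, (k <= l)%N -> extends (X k) (X l)
    & forall j (e : R), 0 < e ->
        exists k, lev (X k) (slot (X k) j) <= e /\ xi (cnt (X k)) <= e].
Proof.
(* Goodness is a premise inside [P] so that [choice] ranges over all states. *)
pose P (Xp : state * (nat * nat)) Y := good Xp.1 -> [/\ good Y, extends Xp.1 Y,
  lev Y (slot Y Xp.2.1) <= Xp.2.2.+1%:R^-1 & xi (cnt Y) <= Xp.2.2.+1%:R^-1].
have [F hF] : {F & forall Xp, P Xp (F Xp)}.
  apply: choice => -[X [j m]]; have [gX|gX] := pselect (good X).
    by have [|Y hY] := @approach X j m.+1%:R^-1 _ gX; [rewrite invr_gt0|exists Y].
  by exists X.
pose X := fix X k := if k is k'.+1 then F (X k', odflt (0, 0)%N (unpickle k'))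
                     else init_state.
have gX k : good (X k).
  elim: k => [|k IH]; first exact: init_good.
  by have [] := hF (X k, odflt (0, 0)%N (unpickle k)) IH.
exists X; split=> //.
- move=> k l /subnKC <-; elim: (l - k)%N => [|m IH]; first by rewrite addn0.
  rewrite addnS; apply: extends_trans IH _.
  by have [] := hF (X (k + m)%N, odflt (0, 0)%N (unpickle (k + m))) (gX _).
- move=> j e e0; pose m := Num.truncn e^-1.
  have me : m.+1%:R^-1 <= e.
    rewrite -[leRHS]invrK lef_pV2 ?posrE ?invr_gt0// ltW//.
    exact: truncnS_gt.
  exists (pickle (j, m)).+1.
  have [_ _] := hF (X (pickle (j, m)), odflt (0, 0)%N (unpickle (pickle (j, m)))) (gX _).
  by rewrite /= pickleK /= => h1 h2; split; apply: le_trans me.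
Qed.

(** [U i] is read off at any stage past [i]. In column [j], the remainder [wt X j ^+ 2] of [inv_col]
    is at most the level divided by [eta j], which becomes arbitrarily small. *)
Lemma limit_rows : exists (U : nat -> nat -> R) (N : nat -> nat),
  [/\ forall i j, (N i <= j)%N -> U i j = 0,
      forall i i' K, (N i <= K)%N -> (N i' <= K)%N ->
        \sum_(j < K) U i j * U i' j = (i == i')%:R,
      forall i, \sum_(j < N i) U i j ^+ 2 * eta j = xi i
    & forall j, series (fun i => U i j ^+ 2) @ \oo --> (1 : R)].
Proof.
have [X [gX eX aX]] := good_sequence.
(* By monotonicity, a stage where [xi (cnt (X k))] is at most [xi i / 2] must be past [i]. *)
have cnt_inf i : {k | (i < cnt (X k))%N}.
  apply: cid; have [k [_ hk]] := aX 0%N (xi i / 2) (divr_gt0 (xi_gt0 i) (ltr0Sn _ 1)).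
  exists k; rewrite ltnNge; apply/negP => /xi_mono; have := xi_gt0 i; lra.
have inv k : {K | ortho_inv (X k) K} by apply: cid; have [] := good_wf (gX k).
pose k_ i := sval (cnt_inf i).
have kE i : (i < cnt (X (k_ i)))%N by exact: svalP (cnt_inf i).
pose U i j := row (X (k_ i)) i j; pose N i := sval (inv (k_ i)).
have iN i : ortho_inv (X (k_ i)) (N i) by exact: svalP (inv (k_ i)).
have UE i j k : (i < cnt (X k))%N -> row (X k) i j = U i j.
  move=> ik; pose m := maxn k (k_ i).
  have [_ <- //] := eX _ _ (leq_maxl k (k_ i)).
  by have [_ -> //] := eX _ _ (leq_maxr k (k_ i)).
have U0 i j : (N i <= j)%N -> U i j = 0 by move=> ?; apply: (inv_row_out (iN i)).
have Ucol j k : \sum_(i < cnt (X k)) U i j ^+ 2 + wt (X k) j ^+ 2 = 1.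
  rewrite -(inv_col (svalP (inv k)) j); congr (_ + _); apply: eq_bigr => i _.
  by rewrite (UE i j k).
exists U, N; split=> //.
- move=> i i' K iK i'K; pose k := maxn (k_ i) (k_ i').
  have ik : (i < cnt (X k))%N.
    by have [c _ _] := eX _ _ (leq_maxl (k_ i) (k_ i')); exact: leq_trans c.
  have i'k : (i' < cnt (X k))%N.
    by have [c _ _] := eX _ _ (leq_maxr (k_ i) (k_ i')); exact: leq_trans c.
  pose L := maxn K (sval (inv k)).
  have iL : ortho_inv (X k) L by apply: ortho_inv_le (svalP (inv k)); exact: leq_maxr.
  rewrite -(@sum_ord_stable _ (fun j => U i j * U i' j) K L) ?leq_maxl//; last first.
    by move=> j Kj; rewrite U0 ?mul0r// (leq_trans iK).
  rewrite -(inv_rows iL ik i'k); apply: eq_bigr => j _.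
  by rewrite !(UE _ _ k).
- by move=> i; exact: (inv_diag (iN i)).
- move=> j; apply/cvgrPdist_le => e e0.
  have [k [hk _]] := aX j (e * eta j) (mulr_gt0 e0 (eta_gt0 j)).
  near=> n; rewrite /series /= big_mkord.
  have wk : wt (X k) j ^+ 2 <= e.
    by rewrite -(ler_pM2r (eta_gt0 j)); apply: le_trans hk; apply: wt_le_lev; exact: good_wf.
  have mono m m' : (m <= m')%N -> \sum_(i < m) U i j ^+ 2 <= \sum_(i < m') U i j ^+ 2.
    move=> /subnKC <-; rewrite big_split_ord /= lerDl sumr_ge0// => i _.
    exact: sqr_ge0.
  have up : \sum_(i < n) U i j ^+ 2 <= 1.
    apply: (@le_trans _ _ (\sum_(i < cnt (X (k_ n))) U i j ^+ 2)).
      by apply: mono; exact: ltnW.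
    by rewrite -(Ucol j (k_ n)) lerDl sqr_ge0.
  have low : 1 - e <= \sum_(i < n) U i j ^+ 2.
    apply: (@le_trans _ _ (\sum_(i < cnt (X k)) U i j ^+ 2)); last first.
      by apply: mono; near: n; exact: nbhs_infty_ge.
    by have := Ucol j k; lra.
  by rewrite ger0_norm ?subr_ge0//; lra.
Unshelve. all: by end_near. Qed.

End Rotations.

(** * From orthonormal rows to a unitary operator *)

Section OrthonormalRows.
Variable R : realType.
Implicit Types x y : nat -> R.

Definition sqsum x : \bar R := (\sum_(0 <= n <oo) (x n ^+ 2)%:E)%E.

Lemma sqsum_ge x n : ((\sum_(i < n) x i ^+ 2)%:E <= sqsum x)%E.
Proof.
apply: le_trans (nneseries_lim_ge n _); first by rewrite big_mkord sumEFin.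
by move=> i _ _; rewrite lee_fin sqr_ge0.
Qed.

Lemma sqsum_le x (C : \bar R) :
  (forall n, (\sum_(i < n) x i ^+ 2)%:E <= C)%E -> (sqsum x <= C)%E.
Proof.
move=> h; apply: lime_le.
  by apply: is_cvg_nneseries => i _ _; rewrite lee_fin sqr_ge0.
by apply: nearW => n; rewrite big_mkord sumEFin.
Qed.

Lemma sqsum_fin x : (sqsum x < +oo)%E -> exists2 C : R, 0 <= C &
  sqsum x = C%:E /\ forall n, \sum_(i < n) x i ^+ 2 <= C.
Proof.
move=> xoo; have x0 : (0 <= sqsum x)%E.
  by have := sqsum_ge x 0; rewrite big_ord0.
have E : sqsum x = (fine (sqsum x))%:E by rewrite fineK// ge0_fin_numE.
exists (fine (sqsum x)); first exact: fine_ge0.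
by split=> // n; rewrite -lee_fin -E sqsum_ge.
Qed.

Variables (U : nat -> nat -> R) (N : nat -> nat).
Hypothesis U_supp : forall i j, (N i <= j)%N -> U i j = 0.
Hypothesis U_rows : forall i i' K, (N i <= K)%N -> (N i' <= K)%N ->
  \sum_(j < K) U i j * U i' j = (i == i')%:R.
Hypothesis U_cols : forall j, series (fun i => U i j ^+ 2) @ \oo --> (1 : R).

(** The matrix and its transpose. Rows have finite support, so [row_op] needs no limit; [col_op]
    does, and [is_cvg_col_op] justifies it. *)
Definition row_op x i : R := \sum_(j < N i) U i j * x j.
Definition col_op y j : R := limn (series (fun i => U i j * y i)).

Lemma row_opE x i K : (N i <= K)%N -> row_op x i = \sum_(j < K) U i j * x j.
Proof.
move=> iK; apply/esym/(@sum_ord_stable _ (fun j => U i j * x j)) => // j ij.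
by rewrite U_supp ?mul0r.
Qed.

Lemma supp_bound n K0 : exists2 K, (K0 <= K)%N & forall i, (i < n)%N -> (N i <= K)%N.
Proof.
exists (maxn K0 (\max_(i < n) N i)); first exact: leq_maxl.
move=> i iN; apply: leq_trans (leq_maxr _ _).
exact: (@leq_bigmax _ (fun i : 'I_n => N i) (Ordinal iN)).
Qed.

Lemma pythagoras y n K : (forall i, (i < n)%N -> (N i <= K)%N) ->
  \sum_(j < K) (\sum_(i < n) U i j * y i) ^+ 2 = \sum_(i < n) y i ^+ 2.
Proof.
move=> hK.
under eq_bigr => j _ do rewrite expr2 mulr_sumr.
rewrite exchange_big /=; apply: eq_bigr => i _.
under eq_bigr => j _ do rewrite mulr_suml.
rewrite exchange_big /= (eq_bigr (fun i' : 'I_n => (i' == i)%:R * (y i' * y i))).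
  rewrite (bigD1 i) //= eqxx mul1r -expr2 [X in _ + X]big1 ?addr0// => i' /negbTE->.
  by rewrite mul0r.
move=> i' _; under eq_bigr => j _ do rewrite mulrACA.
by rewrite -mulr_suml U_rows ?hK.
Qed.

(** Bessel's inequality: [z] is the projection of [x] onto the first [n] rows, and [x - z] has
    nonnegative squared norm. *)
Lemma sqsum_row_op x : (sqsum (row_op x) <= sqsum x)%E.
Proof.
apply: sqsum_le => n; have [K _ hK] := supp_bound n 0.
apply: le_trans (sqsum_ge x K); rewrite lee_fin.
pose z j := \sum_(i < n) U i j * row_op x i.
have zz : \sum_(j < K) z j ^+ 2 = \sum_(i < n) row_op x i ^+ 2 by exact: pythagoras.
have xz : \sum_(j < K) x j * z j = \sum_(i < n) row_op x i ^+ 2.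
  under eq_bigr => j _ do rewrite mulr_sumr.
  rewrite exchange_big /=; apply: eq_bigr => i _.
  rewrite expr2 [in RHS](@row_opE x i K) ?hK// mulrC mulr_sumr.
  by apply: eq_bigr => j _; rewrite (row_opE _ (hK _ (ltn_ord i))); ring.
have : 0 <= \sum_(j < K) (x j - z j) ^+ 2 by rewrite sumr_ge0// => j _; exact: sqr_ge0.
under eq_bigr => j _ do rewrite sqrrB.
by rewrite big_split /= sumrB sumrMnl zz xz; lra.
Qed.

Lemma is_cvg_col_op y j : (sqsum y < +oo)%E -> cvgn (series (fun i => U i j * y i)).
Proof.
move=> yoo; apply: normed_cvg.
apply: (@series_le_cvg _ _ (fun i => U i j ^+ 2 + y i ^+ 2)) => [i|i|i|] /=.
- exact: normr_ge0.
- by rewrite addr_ge0 ?sqr_ge0.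
- have := @weighted_square_le _ (U i j) (y i) 1 ltr01.
  by have := normr_ge0 (U i j * y i); rewrite divr1 mul1r mulr2n; lra.
- apply: is_cvg_seriesD; first by apply/cvg_ex; exists 1; exact: U_cols.
  apply: nnseries_is_cvg => // i; exact: sqr_ge0.
Qed.

(** Convergence is only entrywise, so the first [J] entries are bounded by [pythagoras] for partial
    sums, then passed to the limit, with [J] arbitrary. *)
Lemma sqsum_col_op y : (sqsum y < +oo)%E -> (sqsum (col_op y) <= sqsum y)%E.
Proof.
move=> yoo; have [C C0 [-> hC]] := sqsum_fin yoo.
apply: sqsum_le => J; rewrite lee_fin.
have : (fun n => \sum_(j < J) (series (fun i => U i j * y i) n) ^+ 2) @ \oo -->
    \sum_(j < J) col_op y j ^+ 2.
  apply: (@cvg_sum_ord _ _ (fun j n => series (fun i => U i j * y i) n ^+ 2)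
    (fun j => col_op y j ^+ 2)) => j _.
  by rewrite expr2; apply: cvgM; exact: is_cvg_col_op.
move=> /ler_cvg_to; apply; [exact: cvg_cst|apply: nearW => n].
have [K JK hK] := supp_bound n J.
apply: le_trans (hC n); rewrite -(pythagoras y hK).
under eq_bigr => j _ do rewrite /series /= big_mkord.
rewrite -(subnKC JK) big_split_ord /= lerDl sumr_ge0// => j _; exact: sqr_ge0.
Qed.

(** The finite row [i] can be paired inside the entrywise limit, and for [n > i] its pairing with
    the partial sum is exactly [y i]. *)
Lemma col_opK y : (sqsum y < +oo)%E -> row_op (col_op y) = y.
Proof.
move=> yoo; apply/funext => i.
have : (fun n => \sum_(j < N i) U i j * series (fun i => U i j * y i) n) @ \oo -->
    row_op (col_op y) i.
  apply: (@cvg_sum_ord _ _ (fun j n => U i j * series (fun i => U i j * y i) n)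
    (fun j => U i j * col_op y j)) => j _.
  by apply: cvgMr; exact: is_cvg_col_op.
move=> h; apply/esym; apply: (cvg_unique _ _ h) => //.
apply: cvg_near_cst; near=> n.
have [K iK hK] := supp_bound n (N i).
have ni : (i < n)%N by near: n; exact: nbhs_infty_gt.
under eq_bigr => j _ do rewrite /series /= big_mkord.
rewrite -(@row_opE (fun j => \sum_(i < n) U i j * y i) i (N i))// (row_opE _ iK).
under eq_bigr => j _ do rewrite mulr_sumr.
rewrite exchange_big /= (eq_bigr (fun i' : 'I_n => (i == i')%:R * y i')).
  rewrite (bigD1 (Ordinal ni)) //= eqxx mul1r [X in _ + X]big1 ?addr0// => i' ne.
  case: eqP => [e|_]; last by rewrite mul0r.
  by case/negP: ne; apply/eqP/val_inj.
move=> i' _; under eq_bigr => j _ do rewrite mulrA.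
by rewrite -mulr_suml U_rows// hK.
Unshelve. all: by end_near. Qed.

(* The entry [j] of [x - col_op (row_op x)] is the limit of the pairings of [x] with
   [e_j - \sum_(i < n) U i j *: u_i], whose squared norm is the remainder of the
   column series. *)
Lemma row_opK x : (sqsum x < +oo)%E -> col_op (row_op x) = x.
Proof.
move=> xoo; apply/funext => j; have [C C0 [_ hC]] := sqsum_fin xoo.
apply/cvg_lim => //; apply/cvgrPdist_le => e e0.
(* [t] balances [weighted_square_le]: the norm of [x] contributes [t * C <= e], the remainder, at
   most [e * t], contributes [e]. The [+ 1] guards against [C = 0]. *)
have [t t0 tC] : exists2 t, 0 < t & t * C <= e.
  exists (e / (C + 1)); first by rewrite divr_gt0// ltr_pwDr.
  by rewrite mulrAC ler_pdivrMr ?ltr_pwDr// ler_pM2l//; lra.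
have et0 : 0 < e * t by rewrite mulr_gt0.
near=> n.
have [K jK hK] := supp_bound n j.+1.
pose r k := (k == j)%:R - \sum_(i < n) U i k * U i j.
have deltaE (f : nat -> R) : \sum_(k < K) f k * (k == j :> nat)%:R = f j.
  rewrite (bigD1 (Ordinal jK)) //= eqxx mulr1 big1 ?addr0// => k kj.
  case: eqP => [e'|]; last by rewrite mulr0.
  by case/negP: kj; apply/eqP/val_inj.
have xr : \sum_(k < K) x k * r k = x j - series (fun i => U i j * row_op x i) n.
  under eq_bigr => k _ do rewrite mulrBr.
  rewrite sumrB deltaE /series /= big_mkord; congr (_ - _).
  under eq_bigr => k _ do rewrite mulr_sumr.
  rewrite exchange_big /=; apply: eq_bigr => i _.
  rewrite (row_opE _ (hK _ (ltn_ord i))) mulr_sumr.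
  by apply: eq_bigr => k _; ring.
(* The cross term subtracts the partial column sum twice and [pythagoras] restores it once. *)
have rr : \sum_(k < K) r k ^+ 2 = 1 - \sum_(i < n) U i j ^+ 2.
  under eq_bigr => k _ do rewrite sqrrB.
  rewrite big_split /= sumrB sumrMnl (pythagoras (fun i => U i j) hK).
  rewrite (eq_bigr (fun k : 'I_K => 1 * (k == j :> nat)%:R)); last first.
    by move=> k _; case: eqP; rewrite ?expr1n ?expr0n ?mul1r.
  rewrite (deltaE (fun=> 1)).
  rewrite (eq_bigr (fun k : 'I_K => (\sum_(i < n) U i k * U i j) * (k == j :> nat)%:R)).
    rewrite (deltaE (fun k => \sum_(i < n) U i k * U i j)).
    have -> : \sum_(i < n) U i j * U i j = \sum_(i < n) U i j ^+ 2 by [].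
    by rewrite mulr2n; ring.
  by move=> k _; rewrite mulrC.
have small : \sum_(k < K) r k ^+ 2 <= e * t.
  rewrite rr; have : `|1 - series (fun i => U i j ^+ 2) n| <= e * t.
    by near: n; have /cvgrPdist_le := U_cols j; exact.
  by rewrite /series /= big_mkord => /(le_trans (ler_norm _)).
rewrite -xr.
have : `|\sum_(k < K) x k * r k| *+ 2 <= t * C + (e * t) / t.
  apply: (@le_trans _ _ (\sum_(k < K) (t * x k ^+ 2 + r k ^+ 2 / t))).
    apply: (@le_trans _ _ (\sum_(k < K) `|x k * r k| *+ 2)).
      by rewrite sumrMnl lerMn2r /= ler_norm_sum.
    by apply: ler_sum => k _; exact: weighted_square_le.
  rewrite big_split /= -mulr_sumr -mulr_suml lerD//.
    by rewrite (ler_pM2l t0) hC.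
  by rewrite ler_pM2r// invr_gt0.
rewrite mulfK ?gt_eqF// mulr2n; lra.
Unshelve. all: by end_near. Qed.

(** Both operators are contractions, and [col_op] undoes [row_op]. *)
Lemma sqsum_row_op_eq x : (sqsum x < +oo)%E -> sqsum (row_op x) = sqsum x.
Proof.
move=> xoo; apply/eqP; rewrite eq_le sqsum_row_op /= -[in leLHS](row_opK xoo).
by apply: sqsum_col_op; exact: le_lt_trans (sqsum_row_op x) xoo.
Qed.

(** * The unitary operator on complex sequences *)

Local Notation re x := (fun n => complex.Re (x n)).
Local Notation im x := (fun n => complex.Im (x n)).

Lemma l2_sqnormE (x : nat -> R[i]) : l2_sqnorm x = (sqsum (re x) + sqsum (im x))%E.
Proof.
rewrite /l2_sqnorm /sqsum -nneseriesD; last 2 first.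
- by move=> i _ _; rewrite lee_fin sqr_ge0.
- by move=> i _ _; rewrite lee_fin sqr_ge0.
apply: eq_eseriesr => i _; case: (x i) => a b /=.
by rewrite sqr_sqrtr ?addr_ge0 ?sqr_ge0// EFinD.
Qed.

Lemma in_l2P (x : nat -> R[i]) :
  in_l2 x <-> (sqsum (re x) < +oo)%E /\ (sqsum (im x) < +oo)%E.
Proof.
have s0 (y : nat -> R) : (0 <= sqsum y)%E.
  by have := sqsum_ge y 0; rewrite big_ord0.
rewrite /in_l2 l2_sqnormE; split=> [h|[h1 h2]]; last exact: lte_add_pinfty.
split; apply: le_lt_trans h.
- by rewrite leeDl.
- by rewrite leeDr.
Qed.

Lemma row_op_linear (a : R) x y :
  row_op (fun n => a * x n + y n) = (fun n => a * row_op x n + row_op y n).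
Proof.
apply/funext => i; rewrite /row_op mulr_sumr -big_split /=.
by apply: eq_bigr => j _; ring.
Qed.

(** The real matrix acts separately on real and imaginary parts; [col_op] supplies preimages. *)
Lemma orthogonal_of_rows : orthogonal_matrix U.
Proof.
pose T (x : nat -> R[i]) := fun n => (row_op (re x) n +i* row_op (im x) n)%C.
exists T; last first.
  move=> i j; have dE : row_op (re (l2_basis R j)) i = U i j.
    rewrite (row_opE _ (leq_maxl (N i) j.+1)).
    have jK : (j < maxn (N i) j.+1)%N by rewrite leq_max ltnSn orbT.
    rewrite (bigD1 (Ordinal jK)) //= /l2_basis eqxx mulr1 big1 ?addr0// => k kj.
    case: eqP => [e'|]; last by rewrite mulr0.
    by case/negP: kj; apply/eqP/val_inj.
  have d0 : row_op (im (l2_basis R j)) i = 0.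
    by apply: big1 => k _; rewrite /l2_basis; case: eqP; rewrite /= mulr0.
  by rewrite /T dE d0.
split.
- move=> x /in_l2P[h1 h2]; apply/in_l2P; split; rewrite /T /=.
  + exact: le_lt_trans (sqsum_row_op _) h1.
  + exact: le_lt_trans (sqsum_row_op _) h2.
- move=> [a b] x y _ _; apply/funext => n; rewrite /T.
  have -> : re (fun n => (a +i* b)%C * x n + y n) =
      (fun n => a * re x n + (- b * im x n + re y n)).
    by apply/funext => k; case: (x k) (y k) => [u v] [u' v'] /=; ring.
  have -> : im (fun n => (a +i* b)%C * x n + y n) =
      (fun n => a * im x n + (b * re x n + im y n)).
    by apply/funext => k; case: (x k) (y k) => [u v] [u' v'] /=; ring.
  rewrite !row_op_linear; apply/eqP; rewrite eq_complex /=.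
  by apply/andP; split; apply/eqP; ring.
- move=> x /in_l2P[h1 h2]; rewrite !l2_sqnormE /T /=.
  by rewrite !sqsum_row_op_eq.
- move=> y /in_l2P[h1 h2].
  exists (fun n => (col_op (re y) n +i* col_op (im y) n)%C).
    apply/in_l2P; split; [exact: le_lt_trans (sqsum_col_op h1) h1|].
    exact: le_lt_trans (sqsum_col_op h2) h2.
  by apply/funext => n; rewrite /T /= !col_opK//; case: (y n).
Qed.

End OrthonormalRows.

(** * Row and column sums, and majorization *)

Section OrthogonalMatrixSums.
Variables (R : realType) (U : nat -> nat -> R).
Hypothesis U_orth : orthogonal_matrix U.

Lemma sqsum_trunc (a : nat -> R) n :
  (sqsum (fun k => if (k < n)%N then a k else 0%R) <= (\sum_(k < n) a k ^+ 2)%:E)%E.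
Proof.
apply: sqsum_le => m; rewrite lee_fin.
have [mn|nm] := leqP m n.
  rewrite (eq_bigr (fun k : 'I_m => a k ^+ 2)); last first.
    by move=> k _; rewrite (leq_trans (ltn_ord k) mn).
  rewrite -(subnKC mn) big_split_ord /= lerDl sumr_ge0// => k _; exact: sqr_ge0.
rewrite (@sum_ord_stable _ (fun k => (if (k < n)%N then a k else 0) ^+ 2) _ _ (ltnW nm)).
  by apply: ler_sum => k _; rewrite ltn_ord.
by move=> j; rewrite leqNgt => /negbTE->; rewrite expr0n.
Qed.

Lemma l2_sqnorm_trunc (a : nat -> R) n :
  (l2_sqnorm (fun k => if (k < n)%N then ((a k)%:C)%C else 0%R) <=
   (\sum_(k < n) a k ^+ 2)%:E)%E.
Proof.
rewrite l2_sqnormE -[leRHS]adde0; apply: leeD.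
  apply: le_trans (sqsum_trunc a n).
  rewrite (_ : (fun k => complex.Re _) = fun k => if (k < n)%N then a k else 0)//.
  by apply/funext => k; case: ifP.
rewrite (_ : (fun k => complex.Im _) = fun=> 0).
  by apply: sqsum_le => m; rewrite big1// => k _; rewrite expr0n.
by apply/funext => k; case: ifP.
Qed.

Lemma in_l2_trunc (a : nat -> R) n :
  in_l2 (fun k => if (k < n)%N then ((a k)%:C)%C else 0).
Proof. exact: le_lt_trans (l2_sqnorm_trunc a n) (ltry _). Qed.

Lemma l2_sqnorm_ge (x : nat -> R[i]) n :
  ((\sum_(i < n) complex.Re (x i) ^+ 2)%:E <= l2_sqnorm x)%E.
Proof.
rewrite l2_sqnormE -[leLHS]adde0; apply: leeD; first exact: sqsum_ge (fun i => complex.Re (x i)) n.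
by have := sqsum_ge (fun i => complex.Im (x i)) 0; rewrite big_ord0.
Qed.

(** [T] is prescribed on basis vectors only; linearity extends this to finitely supported vectors,
    on which the isometry can be tested. *)
Lemma orthogonal_trunc (a : nat -> R) n : exists y : nat -> R[i],
  (forall i, complex.Re (y i) = \sum_(j < n) U i j * a j) /\
  (l2_sqnorm y <= (\sum_(j < n) a j ^+ 2)%:E)%E.
Proof.
have [T [Tl2 Tlin Tnorm _] TU] := U_orth.
pose x n : nat -> R[i] := fun k => if (k < n)%N then ((a k)%:C)%C else 0.
have l2x m : in_l2 (x m) by exact: in_l2_trunc.
exists (T (x n)); split; last by rewrite Tnorm//; exact: l2_sqnorm_trunc.
suff -> : T (x n) = fun i => ((\sum_(j < n) U i j * a j)%:C)%C by [].
have basis_l2 j : in_l2 (l2_basis R j).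
  rewrite (_ : l2_basis R j =
    fun k => if (k < j.+1)%N then (((k == j)%:R : R)%:C)%C else 0).
    exact: in_l2_trunc.
  apply/funext => k; rewrite /l2_basis; case: (ltngtP k j) => [kj|kj|->].
  - by rewrite ltnS ltnW.
  - by rewrite ltnS leqNgt kj.
  - by rewrite ltnSn.
elim: n => [|n IH].
  (* [T 0 = 0] is drawn from linearity: [0 = 1 * 0 + 0] gives [T 0 = T 0 + T 0]. *)
  have x0 : x 0%N = fun k => 1 * x 0%N k + x 0%N k.
    by apply/funext => k; rewrite /x /= mulr0 addr0.
  have := Tlin 1 _ _ (l2x 0%N) (l2x 0%N); rewrite -x0 => E.
  apply/funext => i; rewrite big_ord0.
  have /eqP := congr1 (fun f => f i) E.
  by rewrite mul1r -subr_eq0 opprD addNKr oppr_eq0 => /eqP.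
have -> : x n.+1 = fun k => ((a n)%:C)%C * l2_basis R n k + x n k.
  apply/funext => k; rewrite /x /l2_basis; case: (ltngtP k n) => [kn|kn|->].
  - by rewrite ltnS ltnW// mulr0 add0r.
  - by rewrite ltnS leqNgt kn mulr0 addr0.
  - by rewrite ltnSn mulr1 addr0.
rewrite Tlin// IH; apply/funext => i; rewrite TU big_ord_recr /=.
by rewrite -rmorphM -rmorphD addrC [a n * _]mulrC.
Qed.

Lemma orthogonal_col_le1 j n : \sum_(i < n) U i j ^+ 2 <= 1.
Proof.
have [y [yE yn]] := orthogonal_trunc (fun k => (k == j)%:R) j.+1.
have E i : complex.Re (y i) = U i j.
  rewrite yE big_ord_recr /= eqxx mulr1 big1 ?add0r// => k _.
  by rewrite ltn_eqF// mulr0.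
have d : \sum_(k < j.+1) (k == j :> nat)%:R ^+ 2 = 1 :> R.
  rewrite big_ord_recr /= eqxx expr1n big1 ?add0r// => k _.
  by rewrite ltn_eqF// expr0n.
have := le_trans (l2_sqnorm_ge y n) yn; rewrite lee_fin d.
by under eq_bigr do rewrite E.
Qed.

(* Testing the isometry on the truncation of row [i] to its first [n] entries,
   of squared norm [s], gives a vector whose entry [i] is [s]; so [s ^+ 2 <= s]. *)
Lemma orthogonal_row_le1 i n : \sum_(j < n) U i j ^+ 2 <= 1.
Proof.
have [y [yE yn]] := orthogonal_trunc (U i) n.
set s := \sum_(j < n) U i j ^+ 2 in yn *.
have yi : complex.Re (y i) = s by rewrite yE.
have := le_trans (l2_sqnorm_ge y i.+1) yn; rewrite lee_fin big_ord_recr /= yi.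
have : 0 <= \sum_(k < i) complex.Re (y k) ^+ 2.
  by rewrite sumr_ge0// => k _; exact: sqr_ge0.
have : 0 <= s by rewrite sumr_ge0// => k _; exact: sqr_ge0.
nra.
Qed.

End OrthogonalMatrixSums.

(** * Majorization and the two implications *)

Section Majorization.
Variable R : realType.
Implicit Types eta c : nat -> R.

(** Subtract [eta n] from all terms: before [n] the differences are nonnegative with weights at most
    1, from [n] on they are nonpositive, and the total weight of [eta n] is at most [n]. *)
Lemma weighted_sum_le eta c n J :
  (forall k, 0 <= eta k) -> nonincreasing_seq eta ->
  (forall k, 0 <= c k <= 1) -> (forall m, \sum_(k < m) c k <= n%:R) ->
  \sum_(j < J) c j * eta j <= \sum_(j < n) eta j.
Proof.
move=> eta0 eta_mono c01 cn.
have c0 k : 0 <= c k by have /andP[] := c01 k.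
(* Padding to [n + J] terms allows a split at [n] even if [J < n]. *)
apply: (@le_trans _ _ (\sum_(j < n + J) c j * eta j)).
  by rewrite addnC big_split_ord /= lerDl sumr_ge0// => k _; rewrite mulr_ge0.
have -> : \sum_(j < n + J) c j * eta j =
    \sum_(j < n + J) c j * (eta j - eta n) + (\sum_(j < n + J) c j) * eta n.
  by rewrite mulr_suml -big_split /=; apply: eq_bigr => k _; ring.
have -> : \sum_(j < n) eta j = \sum_(j < n) (eta j - eta n) + n%:R * eta n.
  by rewrite sumrB sumr_const card_ord mulr_natl subrK.
apply: lerD; last by rewrite ler_wpM2r.
rewrite big_split_ord /= -[leRHS]addr0; apply: lerD.
  apply: ler_sum => k _; rewrite ler_piMl//; last by have /andP[] := c01 k.
  by rewrite subr_ge0 eta_mono// ltnW.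
by apply: sumr_le0 => k _; rewrite mulr_ge0_le0// subr_le0 eta_mono// leq_addr.
Qed.

Lemma orthostochastic_majorized eta (Q : nat -> nat -> R) :
  co_star eta -> orthostochastic Q -> majorized (matrix_seq_mul Q eta) eta.
Proof.
move=> [eta0 eta_mono _] [U U_orth QE] n.
have Q0 i j : 0 <= Q i j by rewrite QE sqr_ge0.
have row_le i J : \sum_(j < J) Q i j <= 1.
  by under eq_bigr do rewrite QE; exact: orthogonal_row_le1.
have col_le j m : \sum_(i < m) Q i j <= 1.
  by under eq_bigr do rewrite QE; exact: orthogonal_col_le1.
have cvgQ i : cvgn (series (fun j => Q i j * eta j)).
  apply: nnseries_is_cvg => [j|]; first by rewrite mulr_ge0.
  apply: (@le_lt_trans _ _ (eta 0%N)%:E); last exact: ltry.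
  apply: lime_le.
    by apply: is_cvg_nneseries => j _ _; rewrite lee_fin mulr_ge0.
  apply: nearW => J; rewrite sumEFin lee_fin big_mkord.
  apply: (@le_trans _ _ (\sum_(j < J) Q i j * eta 0%N)).
    by apply: ler_sum => j _; rewrite ler_wpM2l// eta_mono.
  by rewrite -mulr_suml ler_piMl.
have : (fun J => \sum_(i < n) series (fun j => Q i j * eta j) J) @ \oo -->
    \sum_(i < n) matrix_seq_mul Q eta i.
  apply: (@cvg_sum_ord _ n (fun i => series (fun j => Q i j * eta j))
    (matrix_seq_mul Q eta)) => i _; exact: cvgQ.
move=> /ler_cvg_to; apply; [exact: cvg_cst|apply: nearW => J].
under eq_bigr do rewrite /series /= big_mkord.
rewrite exchange_big /=.
under eq_bigr do rewrite -mulr_suml.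
(* The weight of [eta j] is the part of column [j] in the first [n] rows. *)
apply: (@weighted_sum_le eta (fun j => \sum_(i < n) Q i j)) => //.
  by move=> k; rewrite col_le andbT sumr_ge0.
move=> m; rewrite exchange_big /=.
apply: (@le_trans _ _ (\sum_(i < n) 1)); first by apply: ler_sum => i _; exact: row_le.
by rewrite sumr_const card_ord.
Qed.

Lemma sum_unbounded (f : nat -> R) : (forall n, 0 <= f n) ->
  ~ cvgn (series f) -> forall B, exists r, B < \sum_(i < r) f i.
Proof.
move=> f0 ncv B; apply: contrapT => /forallNP h; apply: ncv.
apply: nnseries_is_cvg => //; apply: (@le_lt_trans _ _ B%:E); last exact: ltry.
apply: lime_le; first by apply: is_cvg_nneseries => j _ _; rewrite lee_fin.
apply: nearW => r; rewrite sumEFin lee_fin big_mkord leNgt.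
by apply/negP; exact: h.
Qed.

(** After a zero term the sequence vanishes, so its partial sums would stay bounded. *)
Lemma unbounded_gt0 (f : nat -> R) : (forall n, 0 <= f n) ->
  nonincreasing_seq f -> (forall B, exists r, B < \sum_(i < r) f i) ->
  forall n, 0 < f n.
Proof.
move=> f0 mono unb n; rewrite lt_neqAle f0 andbT; apply/eqP => fn.
have [r] := unb (\sum_(i < n) f i); rewrite ltNge => /negP; apply.
rewrite -(@sum_ord_stable _ f n (n + r)) ?leq_addr//; last first.
  by move=> j nj; apply/eqP; rewrite eq_le f0 andbT fn mono.
by rewrite addnC big_split_ord /= lerDl sumr_ge0.
Qed.

(** Majorization passes divergence from [xi] to [eta], so both are strictly positive, as
    [limit_rows] requires. *)
Lemma majorized_orthostochastic (xi eta : nat -> R) :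
  co_star xi -> co_star eta -> ~ l1_star xi -> majorized xi eta ->
  exists2 Q : nat -> nat -> R, orthostochastic Q & xi = matrix_seq_mul Q eta.
Proof.
move=> xi_co [eta0 eta_mono eta_cvg] nl1 maj; have [xi0 xi_mono xi_cvg] := xi_co.
have xi_unb : forall B, exists r, B < \sum_(i < r) xi i.
  by apply: sum_unbounded => // h; apply: nl1.
have eta_unb B : exists r, B < \sum_(i < r) eta i.
  by have [r hr] := xi_unb B; exists r; apply: lt_le_trans hr (maj r).
have xi_gt0 := unbounded_gt0 xi0 xi_mono xi_unb.
have eta_gt0 := unbounded_gt0 eta0 eta_mono eta_unb.
have small (f : nat -> R) e : f @ \oo --> (0 : R) -> (forall n, 0 <= f n) -> 0 < e ->
    exists N, forall n, (N <= n)%N -> f n <= e.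
  move=> /cvgrPdist_le h f0 /h[N _ hN]; exists N => n Nn.
  by have := hN n Nn; rewrite /= sub0r normrN ger0_norm.
have xi_small e : 0 < e -> exists n, xi n <= e.
  by move=> e0; have [n hn] := small _ _ xi_cvg xi0 e0; exists n; exact: hn.
have eta_small e := small _ e eta_cvg eta0.
have [U [N [U_supp U_rows U_diag U_cols]]] :=
  limit_rows xi_gt0 xi_mono xi_small xi_unb eta_gt0 eta_small maj.
exists (fun i j => U i j ^+ 2).
  by exists U => //; apply: (orthogonal_of_rows U_supp U_rows U_cols).
(* Row [i] is supported below [N i], so the partial sums are eventually constant. *)
apply/funext => i; apply/esym/cvg_lim => //; apply: cvg_near_cst; near=> n.
rewrite /series /= big_mkord (@sum_ord_stable _ (fun j => U i j ^+ 2 * eta j) (N i)).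
- exact: U_diag.
- by near: n; exact: nbhs_infty_ge.
- by move=> j ij; rewrite U_supp// expr0n mul0r.
Unshelve. all: by end_near. Qed.

End Majorization.

Theorem theorem5p3 (R : realType) (xi eta : nat -> R)
    (xi_co : co_star xi) (eta_co : co_star eta) (xi_nl1 : ~ l1_star xi) :
  majorized xi eta <->
  exists2 Q : nat -> nat -> R,
    orthostochastic Q & xi = matrix_seq_mul Q eta.
Proof.
split; first exact: majorized_orthostochastic.
by move=> [Q Qo ->]; exact: orthostochastic_majorized.
Qed.
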